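(* Let $\mathcal E,\mathcal F,\mathcal G,\mathcal H$ be non-trivial vector spaces, and let $A\in L(\mathcal E;\mathcal F)$, $B\in L(\mathcal G;\mathcal H)$. (i) If $A$ is a proper silvern transmutation of $B$ by $(P,Q,R,S,T)$, then the restriction of $P$ to $\ker B$ is a linear bijection from $\ker B$ onto $\ker A$, the restriction of $Q$ to $\ker A$ is a linear bijection from $\ker A$ onto $\ker B$, and the restriction of $PQ$ to $\ker A$ is the identity. (ii) Conversely, suppose there is a linear bijection $P$ from $\ker B$ onto $\ker A$, and let $Q$ be its inverse, from $\ker A$ onto $\ker B$. Then for any linear extension of $P$ to $\mathcal G$ (with values in $\mathcal E$, still denoted $P$) and any linear extension of $Q$ to $\mathcal E$ (with values in $\mathcal G$, still denoted $Q$), there exist linear mappings $R\in L(\mathcal H;\mathcal F)$, $S\in L(\mathcal F;\mathcal H)$, $T\in L(\mathcal F;\mathcal E)$ satisfying $RB=AP$, $SA=BQ$ and $TA=\mathrm{Id}_{\mathcal E}-PQ$, and for any such triple $(R,S,T)$, $A$ is a proper silvern transmutation of $B$ by $(P,Q,R,S,T)$.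
   Context: All vector spaces are over the same field; $L(\mathcal X;\mathcal Y)$ is the space of linear mappings from $\mathcal X$ to $\mathcal Y$. For $A\in L(\mathcal E;\mathcal F)$, $B\in L(\mathcal G;\mathcal H)$, $P\in L(\mathcal G;\mathcal E)$, $Q\in L(\mathcal E;\mathcal G)$, $R\in L(\mathcal H;\mathcal F)$, $S\in L(\mathcal F;\mathcal H)$, $T\in L(\mathcal F;\mathcal E)$, one says that $A$ is a silvern transmutation of $B$ by $(P,Q,R,S,T)$ if $AP=RB$, $BQ=SA$ and $PQ+TA=\mathrm{Id}_{\mathcal E}$. It is a proper silvern transmutation if moreover $\ker B\cap\ker P=0$. *)

(* Defs.v *)
From HB Require Import structures.
From mathcomp Require Import all_boot all_order all_algebra.
Set Implicit Arguments.
Unset Strict Implicit.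
Unset Printing Implicit Defensive.
Import GRing.Theory.
Local Open Scope ring_scope.

Section Kernel.
Variables (K : fieldType) (U V : lmodType K) (f : {linear U -> V}).

Definition ker_pred : {pred U} := fun x => f x == 0.

Lemma ker_pred_submod_closed : submod_closed ker_pred.
Proof.
split=> [|a x y]; rewrite !unfold_in ?linear0 //.
by move=> /eqP fx0 /eqP fy0; rewrite linearP fx0 fy0 scaler0 addr0.
Qed.

HB.instance Definition _ :=
  GRing.isSubmodClosed.Build K U ker_pred ker_pred_submod_closed.

Record ker := Ker { ker_val :> U; _ : ker_val \in ker_pred }.

HB.instance Definition _ := [isSub for ker_val].
HB.instance Definition _ := [Choice of ker by <:].
HB.instance Definition _ := [SubChoice_isSubLmodule of ker by <:].
End Kernel.

Section Transmutation.
Variables (K : fieldType) (E F G H : lmodType K).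

(* [f] maps the kernel of [g] to the kernel of [h], where it coincides with
   [f0]; equivalently, [f0] is the restriction of [f], and [f] extends [f0]. *)
Definition extends_ker (U V U' V' : lmodType K) (g : {linear U -> U'})
    (h : {linear V -> V'}) (f : {linear U -> V}) (f0 : ker g -> ker h) : Prop :=
  forall x : ker g, f (val x) = val (f0 x).

Definition silvern_transmutation (A : {linear E -> F}) (B : {linear G -> H})
    (P : {linear G -> E}) (Q : {linear E -> G}) (R : {linear H -> F})
    (S : {linear F -> H}) (T : {linear F -> E}) : Prop :=
  [/\ A \o P =1 R \o B, B \o Q =1 S \o A
    & forall x : E, P (Q x) + T (A x) = x].

Definition proper_silvern_transmutation
    (A : {linear E -> F}) (B : {linear G -> H})
    (P : {linear G -> E}) (Q : {linear E -> G}) (R : {linear H -> F})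
    (S : {linear F -> H}) (T : {linear F -> E}) : Prop :=
  silvern_transmutation A B P Q R S T /\
  (forall x : G, x \in ker_pred B -> x \in ker_pred P -> x = 0).

End Transmutation.

(* Main.v *)
Require Import Defs.
From HB Require Import structures.
From mathcomp Require Import all_boot all_order all_algebra.
From mathcomp Require Import boolp classical_sets.
Import GRing.Theory.
Local Open Scope ring_scope.

(* If [ker f] is contained in [ker g], then [g = h \o f] for some linear [h]
   defined on the whole codomain of [f]; as the spaces may be
   infinite-dimensional, this needs Zorn's lemma. In the converse part this
   produces [R], [S] and [T], because [A \o P], [B \o Q] and [id - P \o Q]
   vanish on [ker B], [ker A] and [ker A] respectively. In the direct part
   [P \o Q = id] on [ker A], and properness makes [P] injective on [ker B], so
   [P] and [Q] restrict to mutually inverse maps of the kernels. *)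

Section LinearFactorization.
Variables (K : fieldType) (U V W : lmodType K).
Variables (f : {linear U -> V}) (g : {linear U -> W}).

(* The subspaces of [V * W] that agree with the relation [f u |-> g u].
   The empty set is allowed, so that the empty chain has an upper bound. *)
Let compatible (S : set (V * W)) : Prop :=
  (forall a x y, S x -> S y -> S (a *: x + y)) /\
  (forall u w, S (f u, w) -> w = g u).

Lemma exists_maximal_compatible :
  exists2 S, compatible S & forall S', (S `<=` S')%classic ->
    compatible S' -> (S' `<=` S)%classic.
Proof.
have [|S [cS maxS]] := @Zorn_bigcup _ compatible.
  move=> C CP tot; split=> [a x y [X CX Xx] [Y CY Yy]|u w [X CX Xw]]; last first.
    exact: (CP _ CX).2 Xw.
  case: (tot _ _ CX CY) => [XY|YX].
    by exists Y => //; apply: (CP _ CY).1 => //; apply: XY.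
  by exists X => //; apply: (CP _ CX).1 => //; apply: YX.
exists S => // S' SS' cS'; apply: contrapT => nS'S.
exact: maxS (conj SS' nS'S) cS'.
Qed.

Hypothesis kerfg : forall u, f u = 0 -> g u = 0.

(** The second clause at [u = 0] makes [S] single-valued, so [S] is the graph of a linear map. A
    maximal compatible [S] is total, since otherwise a line could be adjoined to it. *)
Lemma exists_linear_graph :
  exists S : set (V * W),
    [/\ forall a x y, S x -> S y -> S (a *: x + y),
        forall u w, S (f u, w) -> w = g u
      & forall v, exists w, S (v, w)].
Proof.
have [S [Slin Sfg] maxS] := exists_maximal_compatible.
(* Adjoining [0] keeps compatibility because of [kerfg], so a maximal [S] contains it. *)
have S0 : S 0.
  have c0 : compatible (S `|` [set 0])%classic.
    split=> [a x y|u w [|[fu0 ->]]]; last 2 first.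
    - exact: Sfg.
    - by rewrite kerfg.
    move=> [Sx|->] [Sy|->]; rewrite ?scaler0 ?add0r ?addr0.
    - by left; apply: Slin.
    (* Closure must be applied to [x] alone, as [0] is not yet known to lie in [S]. *)
    - have -> : a *: x = (a - 1) *: x + x by rewrite scalerBl scale1r subrK.
      by left; apply: Slin.
    - by left.
    - by right.
  by apply: (maxS _ _ c0) => [x|]; [left|right].
have SZ a x : S x -> S (a *: x) by move=> Sx; rewrite -[_ *: _]addr0; apply: Slin.
have SB x y : S x -> S y -> S (x - y).
  by move=> Sx Sy; rewrite addrC -scaleN1r; apply: Slin.
exists S; split=> // v0.
(* A value at [v0] is forced as soon as the line through [v0] meets
   [range f] modulo the domain of [S]; otherwise any value will do. *)
have [w0 w0P] : exists w0, forall u s w, S (s, w) -> v0 + s = f u -> w0 + w = g u.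
  have [[u [s [w [Ssw def_fu]]]]|none] :=
    pselect (exists u s w, S (s, w) /\ v0 + s = f u); last first.
    by exists 0 => u s w Ssw def_fu; case: none; exists u, s, w.
  exists (g u - w) => u' s' w' Ssw' def_fu'.
  (* Two constraints on [w0] agree: their difference is a pair of [S] above [f (u' - u)]. *)
  suff E : w' - w = g (u' - u) by rewrite addrAC -addrA E linearB addrC subrK.
  apply: Sfg; rewrite linearB -def_fu -def_fu' opprD addrACA subrr add0r.
  exact: SB Ssw' Ssw.
(* [S] plus the line through [(v0, w0)]; once it is compatible, maximality puts [(v0, w0)] in
   [S]. *)
pose S' : set (V * W) := [set x | exists a y, S y /\ x = a *: (v0, w0) + y]%classic.
exists w0; apply: (maxS S'); last by exists 1, 0; rewrite scale1r addr0.
  by move=> x Sx; exists 0, x; rewrite scale0r add0r.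
split=> [a x y [b [x' [Sx ->]]] [c [y' [Sy ->]]]|u w [a [[s t] [Sst [def_fu ->]]]]].
  exists (a * b + c), (a *: x' + y'); split; first exact: Slin.
  by rewrite scalerDr scalerA scalerDl addrACA.
(* For [a = 0] the pair is already in [S]; otherwise dividing by [a] reduces to [w0P]. *)
have [a0|a_neq0] := eqVneq a 0.
  by apply: Sfg; rewrite def_fu a0 !scale0r !add0r.
have := w0P (a^-1 *: u) _ _ (SZ a^-1 _ Sst).
rewrite !linearZ /= def_fu scalerDr scalerA mulVf // scale1r => /(_ erefl).
by move/(congr1 ( *:%R a)); rewrite scalerDr !scalerA mulfV // !scale1r.
Qed.

Lemma linear_factorization : exists h : {linear V -> W}, forall u, h (f u) = g u.
Proof.
have [S [Slin Sfg Stot]] := exists_linear_graph.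
have [h Sh] := boolp.choice Stot.
have hlin : linear h.
  move=> a x y.
  (* The defect of linearity of [h] is paired in [S] with [0 = f 0], hence equals [g 0 = 0]. *)
  have S0 := Slin (-1) _ _ (Slin a _ _ (Sh x) (Sh y)) (Sh (a *: x + y)).
  apply/eqP; rewrite -subr_eq0 -(linear0 g); apply/eqP/Sfg.
  suff <- : -1 *: (a *: (x, h x) + (y, h y)) + (a *: x + y, h (a *: x + y)) =
    (f 0, h (a *: x + y) - (a *: h x + h y)) by [].
  by rewrite scaleN1r addrC linear0; congr pair; rewrite /= ?subrr.
pose hM := GRing.isLinear.Build K V W _ h hlin.
pose hL : {linear V -> W} := HB.pack h hM.
by exists hL => u; apply: Sfg (Sh _).
Qed.

End LinearFactorization.

Lemma restrict_ker (K : fieldType) (U V U' V' : lmodType K)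
    (g : {linear U -> U'}) (h : {linear V -> V'}) (f : {linear U -> V}) :
  (forall x, g x = 0 -> h (f x) = 0) ->
  exists f0 : {linear ker g -> ker h}, extends_ker f f0.
Proof.
move=> fker.
have fkerP (x : ker g) : f (val x) \in ker_pred h.
  by apply/eqP/fker/eqP; apply: (valP x).
pose f0 x := Ker (fkerP x).
have f0lin : linear f0 by move=> a x y; apply: val_inj; rewrite /= !linearP.
pose f0M := GRing.isLinear.Build K _ _ _ f0 f0lin.
pose f0L : {linear ker g -> ker h} := HB.pack f0 f0M.
by exists f0L.
Qed.

Theorem theorem2p10 (K : fieldType) (E F G H : lmodType K)
    (hE : exists x : E, x != 0) (hF : exists x : F, x != 0)
    (hG : exists x : G, x != 0) (hH : exists x : H, x != 0)
    (A : {linear E -> F}) (B : {linear G -> H}) :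
  (forall (P : {linear G -> E}) (Q : {linear E -> G}) (R : {linear H -> F})
          (S : {linear F -> H}) (T : {linear F -> E}),
     proper_silvern_transmutation A B P Q R S T ->
     [/\ exists2 P0 : {linear ker B -> ker A}, extends_ker P P0 & bijective P0,
         exists2 Q0 : {linear ker A -> ker B}, extends_ker Q Q0 & bijective Q0
       & forall x : ker A, P (Q (val x)) = val x])
  /\
  (forall (P0 : {linear ker B -> ker A}) (Q0 : ker A -> ker B),
     cancel P0 Q0 -> cancel Q0 P0 ->
   forall (P : {linear G -> E}) (Q : {linear E -> G}),
     extends_ker P P0 -> extends_ker Q Q0 ->
     (exists (R : {linear H -> F}) (S : {linear F -> H}) (T : {linear F -> E}),
        [/\ R \o B =1 A \o P, S \o A =1 B \o Q
          & forall x : E, T (A x) = x - P (Q x)])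
     /\
     (forall (R : {linear H -> F}) (S : {linear F -> H}) (T : {linear F -> E}),
        [/\ R \o B =1 A \o P, S \o A =1 B \o Q
          & forall x : E, T (A x) = x - P (Q x)] ->
        proper_silvern_transmutation A B P Q R S T)).
Proof.
split.
  move=> P Q R S T [[AP BQ PQ] proper].
  have PQK x : A x = 0 -> P (Q x) = x by move=> Ax; rewrite -{2}[x]PQ Ax linear0 addr0.
  have [x Bx|P0 P0P] := @restrict_ker _ _ _ _ _ B A P.
    by have /= -> := AP x; rewrite Bx linear0.
  have [x Ax|Q0 Q0P] := @restrict_ker _ _ _ _ _ A B Q.
    by have /= -> := BQ x; rewrite Ax linear0.
  have kerA (x : ker A) : A (val x) = 0 by apply/eqP; apply: (valP x).
  have Q0K : cancel Q0 P0.
    by move=> x; apply: val_inj; rewrite -P0P -Q0P PQK.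
  have P0K : cancel P0 Q0.
    (* [Q0 (P0 x) - x] lies in [ker B] and is killed by [P], so properness applies. *)
    move=> x; apply/eqP; rewrite -subr_eq0; apply/eqP/val_inj/proper.
      exact: valP.
    by apply/eqP; rewrite P0P linearB /= Q0K subrr.
  split=> [||x]; last exact: PQK.
    by exists P0 => //; exists Q0.
  by exists Q0 => //; exists P0.
move=> P0 Q0 P0K Q0K P Q P0P Q0P.
have kerP (U V : lmodType K) (f : {linear U -> V}) x : f x = 0 -> exists y : ker f, val y = x.
  by move=> fx; have xP : x \in ker_pred f by [apply/eqP]; exists (Ker xP).
have ker0 (U V : lmodType K) (f : {linear U -> V}) (x : ker f) : f (val x) = 0.
  by apply/eqP; apply: (valP x).
split; last first.
  move=> R S T [RB SA TA]; split.
    split=> x; [by rewrite RB|by rewrite SA|by rewrite TA addrC subrK].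
  move=> _ /eqP/kerP[x <-] /eqP Px.
  (* Properness amounts to the injectivity of [P0]. *)
  suff -> : x = 0 by [].
  by apply: (can_inj P0K); apply: val_inj; rewrite -P0P Px linear0.
have [x Bx|R RB] := @linear_factorization _ _ _ _ B (A \o P).
  by have [y <-] := kerP _ _ _ _ Bx; rewrite /= P0P ker0.
have [x Ax|S SA] := @linear_factorization _ _ _ _ A (B \o Q).
  by have [y <-] := kerP _ _ _ _ Ax; rewrite /= Q0P ker0.
have [x Ax|T TA] := @linear_factorization _ _ _ _ A (idfun \- (P \o Q)).
  by have [y <-] := kerP _ _ _ _ Ax; rewrite /= Q0P P0P Q0K subrr.
by exists R, S, T.
Qed.
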